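(* There exist an integer $n\ge 2$ and a smooth function $u:\mathbb{R}\times\mathbb{R}^{n-1}\to\mathbb{R}$, with coordinates $(t,x)$, $x=(x_2,\dots,x_n)$, $x_1=t$, satisfying on all of $\mathbb{R}^n$ the Donaldson equation $$u_{11}\,(u_{22}+u_{33}+\cdots+u_{nn})-u_{12}^2-\cdots-u_{1n}^2=1,$$ such that $u$ is not of He's form; that is, $u_{11}$ is not constant, or equivalently $u$ cannot be written as $u(t,x)=at^2+t\,b(x)+g(x)$ with $a$ a nonzero real constant and $b,g:\mathbb{R}^{n-1}\to\mathbb{R}$ smooth functions satisfying $\Delta b=0$ and $\Delta g=\frac{1}{2a}\left(1+|\nabla b|^2\right)$.
   Context: Subscripts denote partial derivatives: $u_{ij}=\partial^2u/\partial x_i\partial x_j$, with $x_1=t$. $\Delta$ and $\nabla$ acting on functions of $x\in\mathbb{R}^{n-1}$ are the Euclidean Laplacian and gradient on $\mathbb{R}^{n-1}$. ''He's form'' refers to the solutions with $u_{11}$ constant, which are exactly those of the form $u(t,x)=at^2+t\,b(x)+g(x)$ with $a\neq0$, $\Delta b=0$, $\Delta g=\frac{1}{2a}(1+|\nabla b|^2)$. *)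

(* Defs.v *)
From HB Require Import structures.
From mathcomp Require Import all_boot all_order all_algebra.
From mathcomp Require Import all_classical all_reals all_analysis.

Set Implicit Arguments.
Unset Strict Implicit.
Unset Printing Implicit Defensive.

Import Order.TTheory GRing.Theory Num.Theory.
Import numFieldNormedType.Exports.

Local Open Scope ring_scope.

Definition partial (R : realType) (k : nat) (i : 'I_k)
    (f : 'rV[R]_k -> R) : 'rV[R]_k -> R :=
  fun p => 'D_(delta_mx 0 i) (f : 'rV[R]_k -> R^o) p.

(* ['D_v f p] is a limit, hence total: [derivable] is required at each order. *)
Fixpoint Cr (R : realType) (k r : nat) (f : 'rV[R]_k -> R) : Prop :=
  continuous f /\
  if r is r'.+1 then
    forall i : 'I_k,
      (forall p, derivable (f : 'rV[R]_k -> R^o) p (delta_mx 0 i)) /\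
      Cr r' (partial i f)
  else True.

Definition smooth (R : realType) (k : nat) (f : 'rV[R]_k -> R) : Prop :=
  forall r, Cr r f.

Definition laplacian (R : realType) (k : nat) (f : 'rV[R]_k -> R) :
    'rV[R]_k -> R :=
  fun x => \sum_(i < k) partial i (partial i f) x.

Definition grad_sqnorm (R : realType) (k : nat) (f : 'rV[R]_k -> R) :
    'rV[R]_k -> R :=
  fun x => \sum_(i < k) partial i f x ^+ 2.

(* A point of R x R^m is a row vector of length [1 + m], namely
   [row_mx t%:M x]: the coordinate t has index [tvar], and the coordinates of x
   have indices [xvar j]. *)
Definition tvar (m : nat) : 'I_(1 + m) := lshift m ord0.
Definition xvar (m : nat) (j : 'I_m) : 'I_(1 + m) := rshift 1 j.
Arguments tvar {m}.

Definition donaldson (R : realType) (m : nat) (u : 'rV[R]_(1 + m) -> R) :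
    Prop :=
  forall p,
    partial tvar (partial tvar u) p
      * (\sum_(j < m) partial (xvar j) (partial (xvar j) u) p)
    - \sum_(j < m) (partial tvar (partial (xvar j) u) p) ^+ 2 = 1.

Definition He_form (R : realType) (m : nat) (u : 'rV[R]_(1 + m) -> R) : Prop :=
  exists (a : R) (b g : 'rV[R]_m -> R),
    [/\ a != 0, smooth b, smooth g,
        forall (t : R) (x : 'rV[R]_m),
          u (row_mx t%:M x) = a * t ^+ 2 + t * b x + g x
      & forall x : 'rV[R]_m,
          laplacian b x = 0 /\
          laplacian g x = (2 * a)^-1 * (1 + grad_sqnorm b x)].

(* Main.v *)
Require Import Defs.
From HB Require Import structures.
From mathcomp Require Import all_boot all_order all_algebra.
From mathcomp Require Import all_classical all_reals all_analysis.
From mathcomp Require Import ring lra.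

Import Order.TTheory GRing.Theory Num.Theory.
Import numFieldNormedType.Exports.

Local Open Scope ring_scope.

(** Separation of variables produces the example.  Look for a solution
    u(t, x) = f(t) |x|^2 + h(t) with x in R^m.  Then u_tt = f'' |x|^2 + h'',
    the Laplacian in x is 2 m f, and |grad_x u_t|^2 = 4 f'^2 |x|^2, so the
    equation splits according to powers of |x| into
    [[
      m f f'' = 2 f'^2     and     2 m f h'' = 1.
    ]]
    For m = 2 the first equation says that log f is affine; f = e^t solves it,
    and the second one then gives h = e^(-t) / 4.  Hence, in dimension n = 3,
    [[
      u(t, x) = e^t (x_2^2 + x_3^2) + e^(-t) / 4
    ]]
    is an entire solution ([donaldson_exp_sol]).  On the axis x = 0 it equals
    e^(-t) / 4, whose second derivative is not constant
    ([exp_sol_tt_not_constant]); nor is it a quadratic polynomial in t, as it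
    would be in He's form ([exp_sol_not_He_form]).

    Smoothness and the values of the derivatives come from one source: the
    functions built from coordinates and constants with +, * and exp are
    differentiable, and their partial derivatives are again of this kind, given
    by a symbolic rule ([partial_eval]).  So smoothness is an induction on the
    order of differentiation ([smooth_eval]), and the equation itself becomes a
    polynomial identity in e^t, e^(-t), x_2, x_3 and the relation
    e^t e^(-t) = 1. *)

(** * Elementary functions of several variables *)

(** Terms rather than functions: an explicit syntax makes differentiation a
    computation. *)
Inductive elementary (R : realType) (k : nat) : Type :=
  | Cst of R
  | Coord of 'I_k
  | Add of elementary R k & elementary R k
  | Mul of elementary R k & elementary R k
  | Exp of elementary R k.

Arguments Cst {R k} _.
Arguments Coord {R k} _.
Arguments Add {R k} _ _.
Arguments Mul {R k} _ _.
Arguments Exp {R k} _.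

Fixpoint eval {R : realType} {k : nat} (e : elementary R k)
    (p : 'rV[R]_k) : R :=
  match e with
  | Cst c => c
  | Coord j => p 0 j
  | Add e1 e2 => eval e1 p + eval e2 p
  | Mul e1 e2 => eval e1 p * eval e2 p
  | Exp e1 => expR (eval e1 p)
  end.

Fixpoint sym_partial {R : realType} {k : nat} (i : 'I_k)
    (e : elementary R k) : elementary R k :=
  match e with
  | Cst _ => Cst 0
  | Coord j => Cst (i == j)%:R
  | Add e1 e2 => Add (sym_partial i e1) (sym_partial i e2)
  | Mul e1 e2 => Add (Mul (sym_partial i e1) e2) (Mul e1 (sym_partial i e2))
  | Exp e1 => Mul (sym_partial i e1) (Exp e1)
  end.

(** Full differentiability, not just existence of the partial derivatives: it
    is what gives continuity and the chain rule in several variables. *)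
Lemma differentiable_eval (R : realType) (k : nat) (e : elementary R k)
    (p : 'rV[R]_k) : differentiable (eval e : 'rV[R]_k -> R^o) p.
Proof.
elim: e => [c|j|e1 IH1 e2 IH2|e1 IH1 e2 IH2|e1 IH1] /=.
- exact: differentiable_cst.
- exact: differentiable_coord.
- exact: differentiableD.
- exact: differentiableM.
- apply: (differentiable_comp IH1 (_ : differentiable (expR : R^o -> R^o) _)).
  exact/derivable1_diffP/derivable_expR.
Qed.

Lemma partial_coord (R : realType) (k : nat) (i j : 'I_k) (p : 'rV[R]_k) :
  partial i (fun q : 'rV[R]_k => q 0 j) p = (i == j)%:R.
Proof.
rewrite /partial /derive; apply: cvg_lim; first exact: norm_hausdorff.
(* A coordinate is linear: its difference quotients are constant. *)
apply: cvg_near_cst; near=> h; rewrite /=.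
have h0 : h != 0 by near: h; exact: nbhs_dnbhs_neq.
by rewrite !mxE addrK eqxx /= eq_sym /GRing.scale /= mulKf.
Unshelve. all: by end_near.
Qed.

Lemma partial_eval (R : realType) (k : nat) (i : 'I_k) (e : elementary R k) :
  partial i (eval e) = eval (sym_partial i e).
Proof.
apply/funext => p; rewrite /partial.
elim: e => [c|j|e1 IH1 e2 IH2|e1 IH1 e2 IH2|e1 IH1] /=.
- exact: derive_cst.
- exact: partial_coord.
- rewrite -IH1 -IH2; apply: deriveD; exact/diff_derivable/differentiable_eval.
- rewrite -IH1 -IH2 addrC [_ * eval e2 p]mulrC.
  apply: deriveM; exact/diff_derivable/differentiable_eval.
- have d1 := differentiable_eval R k e1 p.
  have dexp : differentiable (expR : R^o -> R^o) (eval e1 p).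
    exact/derivable1_diffP/derivable_expR.
  rewrite -IH1 deriveE; last exact: (differentiable_comp d1 dexp).
  rewrite (diff_comp d1 dexp) /= (diff1E dexp) -deriveE //.
  by rewrite derive1E derive_val.
Qed.

(** A class of continuous functions with partial derivatives that stay in the
    class consists of smooth functions. *)
Lemma smooth_eval (R : realType) (k : nat) (e : elementary R k) :
  smooth (eval e).
Proof.
move=> r; have cont e' : continuous (eval e').
  by move=> p; exact/differentiable_continuous/differentiable_eval.
elim: r e => [|r IHr] e; split=> // i; split=> [p|].
  exact/diff_derivable/differentiable_eval.
by rewrite partial_eval; exact: IHr.
Qed.

(** * The solution on R x R^2 *)

Definition exp_sol_term (R : realType) : elementary R (1 + 2) :=
  let t := Coord tvar in
  let x := Coord (xvar ord0) in
  let y := Coord (xvar (lift ord0 ord0)) in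
  Add (Mul (Exp t) (Add (Mul x x) (Mul y y)))
      (Mul (Cst 4^-1) (Exp (Mul (Cst (-1)) t))).

Definition exp_sol (R : realType) : 'rV[R]_(1 + 2) -> R :=
  eval (exp_sol_term R).

Lemma exp_sol_tt (R : realType) (p : 'rV[R]_(1 + 2)) :
  partial tvar (partial tvar (exp_sol R)) p = exp_sol R p.
Proof. by rewrite /exp_sol !partial_eval /=; ring. Qed.

(** Substituting the symbolic derivatives, everything cancels except one
    product e^t e^(-t). *)
Lemma donaldson_exp_sol (R : realType) : donaldson (exp_sol R).
Proof.
move=> p; rewrite /exp_sol !big_ord_recl !big_ord0 !partial_eval /=.
rewrite mulN1r expRN.
have := expR_gt0 (p 0 tvar); move: (expR _) => E E0.
by field; rewrite gt_eqF.
Qed.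

Lemma exp_sol_axis (R : realType) (t : R) :
  exp_sol R (row_mx t%:M 0) = expR (- t) / 4.
Proof.
rewrite /exp_sol /= !row_mxEl !row_mxEr !mxE eqxx mulr1n mulN1r; ring.
Qed.

(** By [exp_sol_tt] a constant u_tt would make u itself constant, which fails
    already between the points t = 0 and t = -1 of the axis x = 0. *)
Lemma exp_sol_tt_not_constant (R : realType) :
  ~ (exists c : R, forall p, partial tvar (partial tvar (exp_sol R)) p = c).
Proof.
move=> [c utt]; have axis t : expR (- t) / 4 = c.
  by rewrite -exp_sol_axis -exp_sol_tt utt.
have := axis (-1); rewrite -(axis 0) opprK oppr0 expR0.
by have := expR_gt1 (1 : R); rewrite ltr01; lra.
Qed.

(** The third finite difference of a quadratic polynomial in t vanishes, whereas
    that of e^(-t) at 0, -1, -2, -3 is (e - 1)^3. *)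
Lemma exp_sol_not_He_form (R : realType) : ~ He_form (exp_sol R).
Proof.
move=> [a [b [g [_ _ _ ubg _]]]].
have axis (k : nat) : expR 1 ^+ k / 4 = a * k%:R ^+ 2 - k%:R * b 0 + g 0 :> R.
  have := ubg (- k%:R) 0; rewrite exp_sol_axis opprK -expRM_natl mulr1 => ->.
  by ring.
have E1 : 1 < expR 1 :> R by rewrite expR_gt1.
have : (expR 1 - 1) ^+ 3 = 0 :> R.
  by have := (axis 0, axis 1, axis 2, axis 3) => -[[[]]]; lra.
by move/eqP; rewrite expf_eq0 /= subr_eq0 gt_eqF.
Qed.

Theorem theorem2 (R : realType) :
  exists n : nat, (2 <= n)%N /\
  exists u : 'rV[R]_(1 + n.-1) -> R,
    [/\ smooth u,
        donaldson u,
        ~ (exists c : R, forall p, partial tvar (partial tvar u) p = c)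
      & ~ He_form u].
Proof.
exists 3%N; split=> //; exists (exp_sol R); split.
- exact: smooth_eval.
- exact: donaldson_exp_sol.
- exact: exp_sol_tt_not_constant.
- exact: exp_sol_not_He_form.
Qed.
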